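(* Let $f$ be convex, let $\mathcal{C}$ be closed and convex, let $h$ be the reference function with Bregman divergence $D$, assume $x_0\in\mathcal{C}\cap\operatorname{int}(\mathcal{X})$ and $x_\star\in\operatorname{ri}(\mathcal{C})\cap\operatorname{int}(\mathcal{X})$, and let $(x_t)_{t\ge 0}$ be the iterates of mirror Polyak, all as specified in the context. If $f$ is $L$-smooth relative to $h$, $L>0$, then for every integer $T\ge 1$, $$ f(\bar x_T)-f_\star \le \frac{L\,D(x_\star,x_0)}{T},\qquad\text{where}\quad \bar x_T := \frac1T\sum_{t=1}^{T}x_t .$$
   Context: Setting: $\mathcal{X}\subseteq\mathbb{R}^d$ is convex with nonempty interior, $f:\mathcal{X}\to\mathbb{R}$ is a proper convex function, and $\mathcal{C}\subseteq\mathbb{R}^d$ is a closed convex set such that $f$ attains a finite minimum $f_\star := f(x_\star)$ over $\mathcal{X}\cap\mathcal{C}$ at a point $x_\star\in\mathcal{X}\cap\mathcal{C}$. $g(x)\in\partial f(x)$ denotes a fixed selection of a subgradient of $f$ at $x$. The reference function $h:\mathcal{X}\to\mathbb{R}$ is a convex function of Legendre type with domain $\mathcal{X}$ (closed proper convex, essentially smooth, strictly convex on $\operatorname{int}(\mathcal{X})$; essentially smooth means that $h$ is differentiable on the nonempty set $\operatorname{int}(\mathcal{X})$ and $\|\nabla h(x_k)\|\to\infty$ whenever $(x_k)$ is a sequence in $\operatorname{int}(\mathcal{X})$ converging to a boundary point of $\mathcal{X}$). Its Bregman divergence is $D(x,y):=h(x)-h(y)-\langle\nabla h(y),x-y\rangle$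 for $x\in\mathcal{X}$, $y\in\operatorname{int}(\mathcal{X})$. $\operatorname{ri}$ denotes relative interior, $\operatorname{int}$ interior. Mirror Polyak: starting from $x_0\in\mathcal{C}\cap\operatorname{int}(\mathcal{X})$, for every $t\ge0$, $$x_{t+1}\in\arg\min_{x\in\mathcal{X}\cap\mathcal{C}} D(x,x_t)\quad\text{such that}\quad f(x_t)+\langle g(x_t),x-x_t\rangle=f_\star .$$ Relative smoothness: $f$ is $L$-smooth relative to $h$ if $f(y)\le f(x)+\langle g(x),y-x\rangle+L\,D(y,x)$ for all $x\in\operatorname{int}(\mathcal{X})$, $y\in\mathcal{X}$. *)

(* Defs.v *)
From mathcomp Require Import all_boot all_order all_algebra.
From mathcomp Require Import all_classical all_reals all_analysis.

Set Implicit Arguments.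
Unset Strict Implicit.
Unset Printing Implicit Defensive.

Import Order.TTheory GRing.Theory Num.Theory.
Import numFieldNormedType.Exports.

Local Open Scope classical_set_scope.
Local Open Scope ring_scope.
Local Open Scope convex_scope.

Section Definitions.
Context {R : realType} {d : nat}.
Local Notation E := 'rV[R]_d.
Implicit Types (X C : set E) (f h : E -> R) (g : E -> E).

Definition dot (u v : E) : R := \sum_(i < d) u 0 i * v 0 i.

(* The library norm on row vectors is the sup norm; it induces the same
   topology. *)
Definition enorm (u : E) : R := Num.sqrt (dot u u).

Definition grad h (x : E) : E := \row_(i < d) 'D_(delta_mx 0 i) h x.

Definition affine_hull C : set E :=
  [set x | exists (n : nat) (c : 'I_n -> R) (p : 'I_n -> E),
    [/\ forall i, C (p i), \sum_(i < n) c i = 1 & x = \sum_(i < n) c i *: p i]].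

Definition relative_interior C : set E :=
  [set x | affine_hull C x /\ \forall y \near x, affine_hull C y -> C y].

(* A function X -> R is a total function whose values outside X are never
   used; the associated extended-valued convex function is +oo there. *)
Definition extension X f (x : E) : \bar R :=
  if x \in X then (f x)%:E else +oo%E.

Definition proper_function (F : E -> \bar R) : Prop :=
  (exists x, F x < +oo)%E /\ (forall x, -oo < F x)%E.

Definition strictly_convex X f : Prop :=
  forall (t : {i01 R}) (x y : convex_lmodType E),
    X x -> X y -> x != y -> 0 < t%:num < 1 ->
    f (x <| t |> y) < (f x : R^o) <| t |> f y.

Definition essentially_smooth X h : Prop :=
  [/\ X° !=set0,
      forall x, X° x -> differentiable h x
    & forall (x_ : nat -> E) (x : E),
        (forall k, X° (x_ k)) -> (closure X `\` X°) x ->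
        x_ @ \oo --> x -> (fun k => enorm (grad h (x_ k))) @ \oo --> +oo].

(* A proper convex function is closed iff it is lower semicontinuous. *)
Definition legendre X h : Prop :=
  [/\ lower_semicontinuous (extension X h),
      proper_function (extension X h),
      convex_function X h,
      essentially_smooth X h
    & strictly_convex X° h].

Definition bregman h (x y : E) : R := h x - h y - dot (grad h y) (x - y).

Definition subdifferential X f (x : E) : set E :=
  [set v | forall y, X y -> f x + dot v (y - x) <= f y].

Definition argmin (S : set E) (phi : E -> R) : set E :=
  [set x | S x /\ forall y, S y -> phi x <= phi y].

(* Membership of the iterates in X° is only assumed at t = 0. *)
Definition mirror_polyak X C f g h (fstar : R) (x_ : nat -> E) : Prop :=
  (C `&` X°) (x_ 0%N) /\
  forall t : nat,
    argmin [set x | (X `&` C) x /\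
                    f (x_ t) + dot (g (x_ t)) (x - x_ t) = fstar]
           (fun x => bregman h x (x_ t)) (x_ t.+1).

Definition relatively_smooth X f g h (L : R) : Prop :=
  forall x y, X° x -> X y ->
    f y <= f x + dot (g x) (y - x) + L * bregman h y x.

Definition average (x_ : nat -> E) (T : nat) : E :=
  T%:R^-1 *: \sum_(1 <= t < T.+1) x_ t.

End Definitions.

(* Main.v *)
Require Import Defs.
From mathcomp Require Import all_boot all_order all_algebra.
From mathcomp Require Import all_classical all_reals all_analysis.
From mathcomp Require Import ring lra.

(** Write D for the Bregman divergence of h, l_t for the linearization of f at
    x_t, xstar for the minimizer and fstar for the minimum.  Each step of the
    method turns out to be a Bregman projection of x_t onto a convex set
    containing xstar, and the core of the proof is the Pythagorean inequality
    for that projection.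

    The slice l_t = fstar onto which the method projects need not contain
    xstar: the subgradient inequality only gives l_t(xstar) <= fstar.  But
    l_t(x_t) = f(x_t) >= fstar, so every point of the half-space l_t <= fstar
    can be moved towards x_t until it meets the hyperplane, and this does not
    increase D(., x_t), which is convex and vanishes at its minimizer x_t.
    Hence x_{t+1} is also the projection onto the half-space
    (argmin_halfspace), which contains xstar.

    The first-order condition for the projection needs the gradient of h at
    x_{t+1}, hence x_{t+1} in the interior of X.  This is where essential
    smoothness enters: minimality along the segment from x_{t+1} to the
    interior point xstar keeps the gradients of h along this segment bounded
    (segment_min_grad_bounded), which is impossible if the segment starts on
    the boundary (segment_min_interior).  Then bregman_projection yields
      D(xstar, x_{t+1}) + D(x_{t+1}, x_t) <= D(xstar, x_t).
    Since l_t(x_{t+1}) = fstar, relative smoothness reads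
      f(x_{t+1}) - fstar <= L D(x_{t+1}, x_t)
                         <= L (D(xstar, x_t) - D(xstar, x_{t+1})),
    which telescopes; Jensen's inequality passes to the averaged iterate
    (convex_average). *)

Set Implicit Arguments.
Unset Strict Implicit.
Unset Printing Implicit Defensive.

Import Order.TTheory GRing.Theory Num.Theory.
Import numFieldNormedType.Exports.

Local Open Scope classical_set_scope.
Local Open Scope ring_scope.

(** * The inner product *)

Section DotProduct.
Context {R : realType} {d : nat}.
Implicit Types u v w : 'rV[R]_d.

Lemma dotDr u v w : dot u (v + w) = dot u v + dot u w.
Proof. by rewrite -big_split; apply: eq_bigr => i _; rewrite mxE mulrDr. Qed.

Lemma dotZr u v (s : R) : dot u (s *: v) = s * dot u v.
Proof. by rewrite mulr_sumr; apply: eq_bigr => i _; rewrite mxE mulrCA. Qed.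

Lemma dotNr u v : dot u (- v) = - dot u v.
Proof. by rewrite -scaleN1r dotZr mulN1r. Qed.

Lemma dotBr u v w : dot u (v - w) = dot u v - dot u w.
Proof. by rewrite dotDr dotNr. Qed.

Lemma dot_delta u i : dot u (delta_mx 0 i) = u 0 i.
Proof.
rewrite /dot (bigD1 i)//= mxE !eqxx mulr1 big1 ?addr0// => j ji.
by rewrite mxE (negbTE ji) andbF mulr0.
Qed.

End DotProduct.

(** * Convexity along segments *)

Section AffineLimits.
Context {R : realType} {V : normedModType R}.
Implicit Types q v z : V.

Lemma cvg_line q v : q + s *: v @[s --> (0 : R)] --> q.
Proof.
rewrite -[X in _ --> X]addr0 -(scale0r v).
by apply: cvgD; [exact: cvg_cst|apply: cvgZr_tmp; exact: cvg_id].
Qed.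

Lemma cvg_dilation z q (k : R) : q + k *: (y - z) @[y --> z] --> q.
Proof.
rewrite -[X in _ --> X]addr0 -[X in _ + X](scaler0 _ k) -(subrr z).
apply: cvgD; first exact: cvg_cst.
by apply: cvgZl_tmp; apply: cvgB; [exact: cvg_id|exact: cvg_cst].
Qed.

End AffineLimits.

Section ConvexSegments.
Context {R : realType} {d : nat}.
Implicit Types (X : set 'rV[R]_d) (f : 'rV[R]_d -> R) (p q v : 'rV[R]_d).

Lemma segment_conv p q (s : R) :
  p + s *: (q - p) = s *: q + (1 - s) *: p.
Proof. by rewrite scalerBr scalerBl scale1r addrC -addrA (addrC (- _)). Qed.

Lemma convex_set_segment X p q (s : R) : convex_set X -> X p -> X q ->
  0 <= s <= 1 -> X (p + s *: (q - p)).
Proof.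
move=> cX Xp Xq /andP[s0 s1]; rewrite segment_conv.
by have := cX q p (Itv01 s0 s1) (mem_set Xq) (mem_set Xp); rewrite inE.
Qed.

Lemma convex_function_segment X f p q (s : R) : convex_function X f ->
  X p -> X q -> 0 <= s <= 1 -> f (p + s *: (q - p)) <= f p + s * (f q - f p).
Proof.
move=> cf Xp Xq /andP[s0 s1]; rewrite segment_conv.
have := cf (Itv01 s0 s1) q p (mem_set Xq) (mem_set Xp).
rewrite convRE /= ?/unstable.onem => /le_trans; apply; lra.
Qed.

(** The dilation centred at p that sends p + s (q - p) to q sends a
    neighbourhood of that point into X; contracting back towards p stays in X
    by convexity. *)
Lemma convex_set_segment_interior X p q (s : R) : convex_set X ->
  X p -> X° q -> 0 < s <= 1 -> X° (p + s *: (q - p)).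
Proof.
move=> cX Xp Xq /andP[s0 s1].
pose z : 'rV[R]_d := p + s *: (q - p).
have cz := @cvg_dilation _ _ z q s^-1.
near=> y.
(* The dilated point q + s^-1 (y - z) lies in X, and y is its contraction. *)
have -> : y = p + s *: ((q + s^-1 *: (y - z)) - p).
  rewrite addrAC scalerDr scalerA divff ?gt_eqF// scale1r addrA.
  by rewrite addrC subrK.
apply: convex_set_segment => //; last by rewrite ltW.
by near: y; apply: cz.
Unshelve. all: by end_near. Qed.

Lemma interior_ray X q v : X° q -> exists2 s : R, 0 < s & X (q + s *: v).
Proof.
move=> Xq.
have /filter_ex : \forall s \near (0 : R)^'+, 0 < s /\ X (q + s *: v).
  near=> s; split; near: s; first exact: nbhs_right_gt.
  exact: (cvg_at_right_filter (@cvg_line _ _ q v) Xq).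
by case=> s [s0 Xs]; exists s.
Unshelve. all: by end_near. Qed.

Lemma average1 (x_ : nat -> 'rV[R]_d) : average x_ 1 = x_ 1%N.
Proof. by rewrite /average big_nat1 invr1 scale1r. Qed.

(** The new average lies on the segment from the old one to the new point, so
    Jensen's inequality follows by induction from its two-point case. *)
Lemma averageS (x_ : nat -> 'rV[R]_d) n : (0 < n)%N ->
  average x_ n.+1 =
  average x_ n + n.+1%:R^-1 *: (x_ n.+1 - average x_ n).
Proof.
move=> n0; rewrite segment_conv /average big_nat_recr//= scalerDr addrC.
congr (_ + _); rewrite scalerA; congr (_ *: _).
by rewrite -natr1; field; rewrite natr1 !pnatr_eq0 -lt0n n0.
Qed.

Lemma convex_average X f (x_ : nat -> 'rV[R]_d) n :
  convex_set X -> convex_function X f -> (forall t, X (x_ t)) -> (0 < n)%N ->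
  X (average x_ n) /\ f (average x_ n) <= n%:R^-1 * \sum_(1 <= t < n.+1) f (x_ t).
Proof.
move=> cX cf Xx; elim: n => // -[_ _|n IH _].
  by rewrite average1 big_nat1 invr1 mul1r.
have [//|Xa fa] := IH.
have w01 : 0 <= (n.+2%:R^-1 : R) <= 1.
  by rewrite invr_ge0 ler0n invf_le1 ?ler1n ?ltr0n.
rewrite averageS//; split; first exact: convex_set_segment.
apply: (le_trans (convex_function_segment cf Xa (Xx _) w01)).
rewrite [X in _ <= _ * X]big_nat_recr//=; set S := \sum_(1 <= t < n.+2) _ in fa *.
have -> : n.+2%:R^-1 * (S + f (x_ n.+2)) =
    n.+1%:R^-1 * S + n.+2%:R^-1 * (f (x_ n.+2) - n.+1%:R^-1 * S).
  by rewrite -[n.+2%:R]natr1; field; rewrite (addrC 1) !natr1 !pnatr_eq0.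
move: w01 fa; move: (_ * S) (_^-1) => b w /andP[w0 w1] fa; nra.
Qed.

End ConvexSegments.

(** * Gradients of convex functions and minimality along a segment *)

Section Gradient.
Context {R : realType} {d : nat}.
Implicit Types (X : set 'rV[R]_d) (h : 'rV[R]_d -> R) (a p q v x y : 'rV[R]_d).

Lemma derive_grad h x v : differentiable h x -> 'D_v h x = dot (grad h x) v.
Proof.
move=> dh; rewrite deriveE// {1}(row_sum_delta v) linear_sum.
by apply: eq_bigr => i _; rewrite linearZ /= mxE -deriveE// mulrC.
Qed.

(** One-sided quotients suffice below, since only the direction that enters X
    is controlled. *)
Lemma cvg_right_quotient h x v : differentiable h x ->
  s^-1 * (h (x + s *: v) - h x) @[s --> (0 : R)^'+] --> dot (grad h x) v.
Proof.
move=> dh; rewrite -derive_grad//.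
have /cvg_dnbhs_at_right : derivable h x v := diff_derivable dh.
by apply: cvg_trans; under eq_fun do rewrite (addrC x).
Qed.

Lemma gradient_inequality X h x y : convex_function X h ->
  differentiable h x -> X x -> X y -> h x + dot (grad h x) (y - x) <= h y.
Proof.
move=> ch dh Xx Xy; rewrite addrC -lerBrDr.
apply: (cvgr_to_le (cvg_right_quotient (v := y - x) dh)).
near=> s.
have s0 : 0 < s by near: s; exact: nbhs_right_gt.
have s1 : s <= 1 by near: s; exact: nbhs_right_le.
rewrite mulrC ler_pdivrMr// lerBlDl mulrC.
by apply: (convex_function_segment ch); rewrite // (ltW s0).
Unshelve. all: by end_near. Qed.

(** With a the gradient of h at y, the function h - <a, .> differs from the
    Bregman divergence D(., y) by a constant: this is minimality of D(., y) at
    p along the segment from p to q, in a form that no longer mentions y. *)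
Definition tilted_segment_min h a p q := forall s : R, 0 <= s <= 1 ->
  h p - dot a p <= h (p + s *: (q - p)) - dot a (p + s *: (q - p)).

Lemma segment_min_gradient h a p q : differentiable h p ->
  tilted_segment_min h a p q -> dot a (q - p) <= dot (grad h p) (q - p).
Proof.
move=> dh mp; apply: (cvgr_to_ge (cvg_right_quotient (v := q - p) dh)).
near=> s.
have s0 : 0 < s by near: s; exact: nbhs_right_gt.
have s1 : s <= 1 by near: s; exact: nbhs_right_le.
rewrite mulrC ler_pdivlMr//.
have := mp s; rewrite (ltW s0) s1 dotDr dotZr => /(_ erefl); lra.
Unshelve. all: by end_near. Qed.

(** Let G be the gradient at z = p + s (q - p).  Minimality at p and convexity
    bound <G, q - p> below by <a, q - p>, so the gradient inequality from z to
    p and to q + r v, where r > 0 keeps q + r v in X, leaves the bound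
    r <G, v> <= h (q + r v) - h p - <a, q - p>, in which s has disappeared. *)
Lemma segment_min_grad_bounded X h a p q v : convex_set X ->
  convex_function X h -> (forall x, X° x -> differentiable h x) ->
  X p -> X° q -> tilted_segment_min h a p q ->
  exists K, forall s : R, 0 < s <= 1 ->
    dot (grad h (p + s *: (q - p))) v <= K.
Proof.
move=> cX ch dh Xp Xq mp.
have [r r0 Xr] := interior_ray v Xq.
exists ((h (q + r *: v) - h p - dot a (q - p)) / r) => s s01.
have Xz := convex_set_segment_interior cX Xp Xq s01.
have /andP[s0 s1] := s01.
set z := p + _ in Xz *.
have gi := gradient_inequality ch (dh _ Xz) (interior_subset Xz).
have := gi _ Xr; have := gi _ Xp.
have -> : q + r *: v - z = (1 - s) *: (q - p) + r *: v.
  by rewrite scalerBl scale1r /z; apply/rowP => i; rewrite !mxE; lra.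
have -> : p - z = - s *: (q - p).
  by rewrite /z; apply/rowP => i; rewrite !mxE; lra.
have := mp s; rewrite (ltW s0) s1 => /(_ erefl); rewrite -/z.
have -> : dot a z = dot a p + s * dot a (q - p) by rewrite /z [LHS]dotDr dotZr.
rewrite [dot _ (_ + r *: v)]dotDr !dotZr ler_pdivlMr// => m1 m2 m3.
(* Minimality and the gradient inequality at p sandwich h z - h p. *)
have m4 : dot a (q - p) <= dot (grad h z) (q - p).
  by rewrite -(ler_pM2l s0); lra.
by nra.
Qed.

(** If p were a boundary point, the gradients along points of the segment
    converging to p would blow up, whereas each of their coordinates is
    bounded. *)
Lemma segment_min_interior X h a p q : convex_set X ->
  convex_function X h -> essentially_smooth X h ->
  X p -> X° q -> tilted_segment_min h a p q -> X° p.
Proof.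
move=> cX ch [_ dh steep] Xp Xq mp; apply: contrapT => Xp'.
pose z n : 'rV[R]_d := p + n.+1%:R^-1 *: (q - p).
have n01 n : 0 < (n.+1%:R^-1 : R) <= 1.
  by rewrite invr_gt0 ltr0n invf_le1 ?ler1n ?ltr0n.
have Xz n : X° (z n) by exact: convex_set_segment_interior.
have cz : z @ \oo --> p.
  exact: (cvg_comp _ _ (@cvg_harmonic R) (@cvg_line _ _ p (q - p))).
(* Both coordinate signs: bounds in the directions e_i and - e_i. *)
have : forall i, exists K, forall n, `|grad h (z n) 0 i| <= K.
  move=> i; have B v := @segment_min_grad_bounded X h a p q v cX ch dh Xp Xq mp.
  have [K1 B1] := B (delta_mx 0 i); have [K2 B2] := B (- delta_mx 0 i).
  exists (Num.max K1 K2) => n.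
  have := B2 _ (n01 n); have := B1 _ (n01 n); rewrite dotNr dot_delta => b1 b2.
  by rewrite ler_norml lerNl !le_max b1 b2 orbT.
move=> /choice[K BK].
have /cvgryPgt /(_ (Num.sqrt (\sum_i K i ^+ 2))) := steep z p Xz
  (conj (subset_closure Xp) Xp') cz.
move=> /filter_ex[n] /=; apply/negP; rewrite -leNgt ler_wsqrtr//.
apply: ler_sum => i _; have := BK i n; rewrite ler_norml => /andP[? ?]; nra.
Qed.

End Gradient.

(** * Bregman projections *)

Section Bregman.
Context {R : realType} {d : nat}.
Implicit Types (X : set 'rV[R]_d) (h : 'rV[R]_d -> R) (x y z : 'rV[R]_d).

Lemma bregman_self h x : bregman h x x = 0.
Proof. by rewrite /bregman dotBr !subrr. Qed.

Lemma bregman_ge0 X h x y : convex_function X h -> differentiable h y ->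
  X x -> X y -> 0 <= bregman h x y.
Proof.
by move=> ch dh Xx Xy; have := gradient_inequality ch dh Xy Xx; rewrite /bregman; lra.
Qed.

Lemma bregman_convex X h p q y (s : R) : convex_function X h ->
  X p -> X q -> 0 <= s <= 1 ->
  bregman h (p + s *: (q - p)) y <= bregman h p y + s * (bregman h q y - bregman h p y).
Proof.
move=> ch Xp Xq s01; have := convex_function_segment ch Xp Xq s01.
rewrite /bregman !(dotBr, dotDr, dotZr); lra.
Qed.

(** The difference between the two sides is <grad h p - grad h y, q - p>,
    whose sign is the first-order condition at the minimizer p. *)
Lemma bregman_projection X S h p q y : convex_set X -> convex_set S ->
  convex_function X h -> essentially_smooth X h -> S `<=` X ->
  argmin S (fun x => bregman h x y) p -> S q -> X° q ->
  X° p /\ bregman h q p + bregman h p y <= bregman h q y.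
Proof.
move=> cX cS ch eh SX [Sp mp] Sq Xq.
have sm : tilted_segment_min h (grad h y) p q.
  move=> s s01; have := mp _ (convex_set_segment cS Sp Sq s01).
  by rewrite /bregman !dotBr; lra.
have Xp : X° p by apply: (segment_min_interior cX ch eh _ Xq sm); exact: SX.
split=> //; have [_ dh _] := eh.
have := segment_min_gradient (dh _ Xp) sm.
by rewrite /bregman !dotBr; lra.
Qed.

(** The segment from y, where the affine constraint is at least c, to a point q
    where it is at most c meets the hyperplane, and along it D(., y) is at most
    D(q, y), being convex with value 0 at y. *)
Lemma argmin_halfspace X S h v y p (b c : R) : convex_set S ->
  convex_function X h -> differentiable h y -> S `<=` X ->
  S y -> c <= b ->
  argmin [set x | S x /\ b + dot v (x - y) = c] (fun x => bregman h x y) p ->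
  argmin [set x | S x /\ b + dot v (x - y) <= c] (fun x => bregman h x y) p.
Proof.
move=> cS ch dh SX Sy cb [[Sp pc] mp]; split; first by split=> //; rewrite pc.
move=> q [Sq qc].
have Dq := bregman_ge0 ch dh (SX _ Sq) (SX _ Sy).
have [s s01 sc] : exists2 s : R, 0 <= s <= 1 & b + s * dot v (q - y) = c.
  (* If c = b, then y is on the hyperplane and dot v (q - y) may vanish. *)
  have [->|cb'] := eqVneq c b; first by exists 0; [lra|rewrite mul0r addr0].
  have bc : c < b by rewrite lt_neqAle cb'.
  have D0 : dot v (q - y) < 0 by lra.
  exists ((c - b) / dot v (q - y)); last by rewrite divfK ?lt_eqF//; lra.
  by rewrite ler_ndivlMr// ler_ndivrMr//; apply/andP; split; lra.
have Ss := convex_set_segment cS Sy Sq s01.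
apply: le_trans (mp (y + s *: (q - y)) _) _.
  by split=> //; rewrite addrAC subrr add0r dotZr.
have := bregman_convex y ch (SX _ Sy) (SX _ Sq) s01.
rewrite bregman_self => /le_trans; apply; nra.
Qed.

End Bregman.

(** * Convergence of the averaged iterates *)

Theorem theorem6 (R : realType) (d : nat) (X C : set 'rV[R]_d)
    (f h : 'rV[R]_d -> R) (g : 'rV[R]_d -> 'rV[R]_d)
    (xstar : 'rV[R]_d) (x_ : nat -> 'rV[R]_d) (L : R)
    (hX : convex_set X) (hX0 : X° !=set0)
    (hf_proper : proper_function (extension X f)) (hf : convex_function X f)
    (hC_closed : closed C) (hC : convex_set C)
    (hxstar : argmin (X `&` C) f xstar)
    (hxstar_int : (relative_interior C `&` X°) xstar)
    (hg : forall x, X° x -> subdifferential X f x (g x))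
    (hh : legendre X h)
    (hx : mirror_polyak X C f g h (f xstar) x_)
    (hL : 0 < L) (hsmooth : relatively_smooth X f g h L)
    (T : nat) (hT : (1 <= T)%N) :
  f (average x_ T) - f xstar <= L * bregman h xstar (x_ 0%N) / T%:R.
Proof.
have [_ _ ch eh _] := hh.
have [_ dh _] := eh.
have [[x0C x0X] hstep] := hx.
have [[xsX xsC] fmin] := hxstar.
have [_ xsI] := hxstar_int.
have cXC : convex_set (X `&` C).
  move=> x y s; rewrite !inE => -[Xx Cx] [Xy Cy].
  by split; apply: set_mem; [apply: hX|apply: hC]; apply: mem_set.
(* One step: the Pythagorean inequality combined with relative smoothness. *)
have step t : C (x_ t) -> X° (x_ t) ->
    [/\ C (x_ t.+1), X° (x_ t.+1) &
      f (x_ t.+1) - f xstar <=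
        L * (bregman h xstar (x_ t) - bregman h xstar (x_ t.+1))].
  move=> Ct It; have Xt := interior_subset It.
  have am := argmin_halfspace cXC ch (dh _ It) (@subIsetl _ _ _)
    (conj Xt Ct) (fmin _ (conj Xt Ct)) (hstep t).
  set S := [set x | _] in am.
  have cS : convex_set S.
    move=> x y s; rewrite !inE => -[XCx xc] [XCy yc]; split.
      by apply: set_mem; apply: cXC; apply: mem_set.
    have /andP[s0 s1] : 0 <= s%:num <= 1 by rewrite ge0 le1.
    have : s%:num * dot (g (x_ t)) (x - x_ t) +
        (1 - s%:num) * dot (g (x_ t)) (y - x_ t) <= f xstar - f (x_ t) by nra.
    rewrite !dotBr dotDr !dotZr /unstable.onem; lra.
  have Ss : S xstar by split=> //; exact: hg.
  have [I1 D1] := bregman_projection hX cS ch eh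
    (fun x Sx => Sx.1.1) am Ss xsI.
  have [[[X1 C1] e1] _] := hstep t.
  split=> //; have := hsmooth _ _ It X1; rewrite e1 => ?.
  rewrite lerBlDl; apply: le_trans; first by eassumption.
  by rewrite lerD2l ler_pM2l//; lra.
have inv t : C (x_ t) /\ X° (x_ t).
  by elim: t => // t [Ct It]; have [] := step t Ct It.
have Xx t : X (x_ t) by apply: interior_subset; exact: (inv t).2.
have sumle n : \sum_(1 <= t < n.+1) f (x_ t) <= n%:R * f xstar +
    L * (bregman h xstar (x_ 0%N) - bregman h xstar (x_ n)).
  elim: n => [|n IH]; first by rewrite big_nil mul0r subrr mulr0 addr0.
  rewrite big_nat_recr//= -natr1.
  by have [_ _] := step n (inv n).1 (inv n).2; lra.
have [_ ] := convex_average hX hf Xx hT.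
have DT : 0 <= bregman h xstar (x_ T).
  by apply: (bregman_ge0 ch) => //; apply: dh; exact: (inv T).2.
have T0 : 0 < T%:R :> R by rewrite ltr0n.
move=> /le_trans fT; rewrite lerBlDr; apply: fT.
rewrite mulrC ler_pdivrMr// mulrDl divfK ?gt_eqF//.
by apply: (le_trans (sumle T)); nra.
Qed.
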